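(* Consider the optimization problem $\min_{z\in\mathscr{H}} h(z)+\phi(z)$, where $h:\mathscr{H}\to\mathbb{R}$ is continuously differentiable and convex and $\phi:\mathscr{H}\to\mathbb{R}$ is proper, convex and lower semicontinuous. Assume that $h$ is strongly convex with constant $\eta>0$, that $\nabla h$ is Lipschitz continuous with constant $L>0$, and that $\gamma>0$ satisfies $\gamma L^2<2\eta$. Let $z^*$ be a solution of the problem. Let $$\Phi(z)=z-\mathrm{prox}_{\gamma\phi}(z-\gamma\nabla h(z))$$ and consider the differential equation $$\dot z=-\frac{K_p}{T_p}\,\omega(z)\,\Phi(z),\qquad(\ast)$$ where $\omega(z)=b_1\|\Phi(z)\|^{-(1-p_1)}+b_2\|\Phi(z)\|^{-(1-p_2)}+b_3\|\Phi(z)\|^{-p_3}$ if $\Phi(z)\neq0$ and $\omega(z)=0$ if $\Phi(z)=0$, with $b_1,b_2,b_3>0$, $p_1\in(0,1)$, $p_2>1$, $p_3\ge0$ and $K_p,T_p>0$. Then: (1) $z^*$ is a fixed-time stable equilibrium point of $(\ast)$, and there are constants $M_1>0$, $M_2>0$, $r_1\in(0.5,1)$, $r_2>1$ such that the settling time satisfies, for every $z(0)\in\mathscr{H}$, $$T(z(0))\le T_{\max}=\frac{1}{M_1(1-r_1)}+\frac{1}{M_2(r_2-1)}.$$ (2) In addition, if $r_1=1-\frac{1}{2\alpha}$ and $r_2=1+\frac{1}{2\alpha}$ for some $\alpha>1$, then $$T(z(0))\le T_{\max}=\frac{\pi\alpha}{\sqrt{M_1M_2}}.$$ (3) Furthermore,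 when $p_3=0$, the equilibrium point of $(\ast)$ is predefined-time stable (with predefined time $T_p$), with the constant $$K_p=\frac{1}{b_3(1-c)(1-p_1)}\ln\!\left(1+\frac{b_3\,2^{\frac{1-p_1}{2}}(1+c)^{1-p_1}}{b_1}\right)+\frac{1}{b_3(1-c)(p_2-1)}\ln\!\left(1+\frac{b_3\,2^{\frac{1-p_2}{2}}(1-c)^{1-p_2}}{b_2}\right),$$ where $c\in(0,1)$ is a Lipschitz constant of the operator $z\mapsto\mathrm{prox}_{\gamma\phi}(z-\gamma\nabla h(z))$.
   Context: $\mathscr{H}$ is a real finite-dimensional Hilbert space with inner product $\langle\cdot,\cdot\rangle$ and norm $\|\cdot\|$. The proximity operator is $\mathrm{prox}_{\gamma\phi}(z)=\arg\min_{w\in\mathscr{H}}\{\phi(w)+\frac{1}{2\gamma}\|z-w\|^2\}$. Strong convexity of $h$ with constant $\eta$ is normalized so that $\langle\nabla h(z)-\nabla h(w),z-w\rangle\ge\eta\|z-w\|^2$ for all $z,w$. Under the stated assumptions it is known that the operator $z\mapsto\mathrm{prox}_{\gamma\phi}(z-\gamma\nabla h(z))$ is Lipschitz with some constant $c\in(0,1)$. For an autonomous differential equation, an equilibrium point is a point where the right-hand side vanishes. An equilibrium $z^*$ is Lyapunov stable if for every $\varepsilon>0$ there is $r>0$ such that any solution with $z(0)\in B(z^*,r)$ (the ball of radius $r$ centred at $z^*$) stays in $B(z^*,\varepsilon)$ for all $t>0$. The settling time $T(z(0))$ is the time after which the trajectory starting at $z(0)$ has reached $z^*$ and remains there. $z^*$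 is globally finite-time stable if it is Lyapunov stable and the settling time is finite for all initial conditions in $\mathscr{H}$; (globally) fixed-time stable if moreover the settling time is uniformly bounded over all initial conditions; predefined-time stable if it is globally fixed-time stable and the system parameters can be adjusted so that the settling time can be prescribed in advance (here: every trajectory reaches the equilibrium within the user-chosen time $T_p>0$). *)

(* Defs.v *)
From HB Require Import structures.
From mathcomp Require Import all_boot all_order all_algebra.
From mathcomp Require Import all_classical all_reals all_analysis.
Import Order.TTheory GRing.Theory Num.Theory.
Import numFieldNormedType.Exports.

Set Implicit Arguments.
Unset Strict Implicit.
Unset Printing Implicit Defensive.

Local Open Scope classical_set_scope.
Local Open Scope ring_scope.

(* A real finite-dimensional Hilbert space is a normed module [H] together with
   [dot : {dot H for idfun}] (bilinear, symmetric, positive definite) such that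
   [dot] induces the norm of [H] and [H] is spanned by finitely many vectors. *)
Definition induces_norm (R : realType) (H : normedModType R)
    (dot : H -> H -> R) : Prop :=
  forall x : H, `|x| ^+ 2 = dot x x.

Definition finite_dimensional (R : realType) (H : normedModType R) : Prop :=
  exists (n : nat) (e : 'I_n -> H),
    forall x : H, exists a : 'I_n -> R, x = \sum_(i < n) a i *: e i.

(* By convention [get A] is a default point when [A] is empty: [gradient] and
   [prox] have their usual meaning where a gradient, resp. a minimizer, exists. *)
Definition gradient (R : realType) (H : normedModType R)
    (dot : H -> H -> R) (h : H -> R^o) (x : H) : H :=
  get [set g : H | forall v : H, 'd h x v = dot g v].

Definition continuously_differentiable (R : realType) (H : normedModType R)
    (dot : H -> H -> R) (h : H -> R^o) : Prop :=
  (forall x : H, differentiable h x) /\ continuous (gradient dot h).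

(* Normalized so that [h - eta / 2 * `|.|^2] is convex. *)
Definition strongly_convex (R : realType) (H : normedModType R)
    (dot : H -> H -> R) (eta : R) (h : H -> R^o) : Prop :=
  forall z w : H,
    dot (gradient dot h z - gradient dot h w) (z - w) >= eta * `|z - w| ^+ 2.

Definition proper_function (T : Type) (R : realType) (f : T -> \bar R) : Prop :=
  (forall x, f x != -oo%E) /\ (exists x, f x != +oo%E).

(* Meant for functions that avoid [-oo]; recall that [0 * +oo = 0]. *)
Definition ereal_convex (R : realType) (H : normedModType R)
    (f : H -> \bar R) : Prop :=
  forall (x y : H) (t : R), 0 <= t -> t <= 1 ->
    (f (t *: x + (1 - t) *: y)%R <= t%:E * f x + (1 - t)%:E * f y)%E.

Definition is_minimizer (T : Type) (R : realType) (f : T -> \bar R) (x : T) :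
  Prop := forall y : T, (f x <= f y)%E.

Definition prox (R : realType) (H : normedModType R) (gamma : R)
    (phi : H -> \bar R) (z : H) : H :=
  get [set w : H |
    is_minimizer (fun u : H => phi u + ((2 * gamma)^-1 * `|z - u| ^+ 2)%R%:E)%E w].

Definition forward_backward (R : realType) (H : normedModType R)
    (dot : H -> H -> R) (h : H -> R^o) (phi : H -> \bar R) (gamma : R)
    (z : H) : H :=
  prox gamma phi (z - gamma *: gradient dot h z).

Definition residual (R : realType) (H : normedModType R)
    (dot : H -> H -> R) (h : H -> R^o) (phi : H -> \bar R) (gamma : R)
    (z : H) : H :=
  z - forward_backward dot h phi gamma z.

Definition omega (R : realType) (H : normedModType R)
    (b1 b2 b3 p1 p2 p3 : R) (Phi : H -> H) (z : H) : R :=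
  if Phi z == 0 then 0
  else b1 * `|Phi z| `^ (- (1 - p1)) + b2 * `|Phi z| `^ (- (1 - p2))
       + b3 * `|Phi z| `^ (- p3).

Definition flow_field (R : realType) (H : normedModType R)
    (Kp b1 b2 b3 p1 p2 p3 : R) (Phi : H -> H) (Tp : R) (z : H) : H :=
  - ((Kp / Tp * omega b1 b2 b3 p1 p2 p3 Phi z) *: Phi z).

(* Forward solutions on [0, +oo[ in the sense of Caratheodory,
   z(t) = z(0) + \int_0^t F(z(s)) ds, the vector integral being tested against
   every v : H. This is the class of C^1 solutions when F is continuous along
   the trajectory; [flow_field] is discontinuous at its equilibrium if p3 >= 1,
   and then a trajectory has no derivative at the time it reaches it. Only the
   restriction of [z] to nonnegative times matters. *)
Definition is_solution (R : realType) (H : normedModType R)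
    (dot : H -> H -> R) (F : H -> H) (z : R -> H) : Prop :=
  forall (t : R) (v : H), 0 <= t ->
    lebesgue_measure.-integrable `[0, t] (EFin \o (fun s => dot (F (z s)) v)) /\
    dot (z t) v =
      dot (z 0) v + \int[lebesgue_measure]_(s in `[0, t]) dot (F (z s)) v.

Definition equilibrium (R : realType) (H : normedModType R) (F : H -> H)
    (zs : H) : Prop := F zs = 0.

Definition lyapunov_stable (R : realType) (H : normedModType R)
    (dot : H -> H -> R) (F : H -> H) (zs : H) : Prop :=
  equilibrium F zs /\
  forall eps : R, 0 < eps -> exists2 r : R, 0 < r &
    forall z : R -> H, is_solution dot F z -> ball zs r (z 0) ->
      forall t : R, 0 < t -> ball zs eps (z t).

(* [+oo] if the trajectory [z] does not settle at [zs]. *)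
Definition settling_time (R : realType) (H : normedModType R) (zs : H)
    (z : R -> H) : \bar R :=
  ereal_inf [set T%:E | T in
    [set T : R | 0 <= T /\ forall t : R, T <= t -> z t = zs]].

Definition globally_finite_time_stable (R : realType) (H : normedModType R)
    (dot : H -> H -> R) (F : H -> H) (zs : H) : Prop :=
  lyapunov_stable dot F zs /\
  forall z : R -> H, is_solution dot F z -> (settling_time zs z < +oo)%E.

Definition settles_within (R : realType) (H : normedModType R)
    (dot : H -> H -> R) (F : H -> H) (zs : H) (Tmax : R) : Prop :=
  forall z : R -> H, is_solution dot F z -> (settling_time zs z <= Tmax%:E)%E.

Definition fixed_time_stable (R : realType) (H : normedModType R)
    (dot : H -> H -> R) (F : H -> H) (zs : H) : Prop :=
  globally_finite_time_stable dot F zs /\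
  exists Tmax : R, settles_within dot F zs Tmax.

(* [F] is a family of systems indexed by the time [Tp] prescribed in advance. *)
Definition predefined_time_stable (R : realType) (H : normedModType R)
    (dot : H -> H -> R) (F : R -> H -> H) (zs : H) : Prop :=
  forall Tp : R, 0 < Tp ->
    fixed_time_stable dot (F Tp) zs /\ settles_within dot (F Tp) zs Tp.

Definition predefined_gain (R : realType) (b1 b2 b3 p1 p2 c : R) : R :=
  (b3 * (1 - c) * (1 - p1))^-1 *
    ln (1 + b3 * 2 `^ ((1 - p1) / 2) * (1 + c) `^ (1 - p1) / b1) +
  (b3 * (1 - c) * (p2 - 1))^-1 *
    ln (1 + b3 * 2 `^ ((1 - p2) / 2) * (1 - c) `^ (1 - p2) / b2).

(* Main.v *)
Require Import Defs.
From HB Require Import structures.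
From mathcomp Require Import all_boot all_order all_algebra.
From mathcomp Require Import all_classical all_reals all_analysis.
From mathcomp Require Import ring lra.
Import Order.TTheory GRing.Theory Num.Theory.
Import numFieldNormedType.Exports.
Local Open Scope classical_set_scope.
Local Open Scope ring_scope.

(** Write T for the forward-backward operator
    [prox (gamma * phi) (id - gamma * gradient h)], so that the system is
    [z' = - (Kp / Tp) * omega z * Phi z] with [Phi = id - T].

    Why the equilibrium attracts.  The proximity operator is nonexpansive
    because subgradients are monotone ([prox_nonexpansive]), and the gradient
    step is a contraction because [h] is strongly convex with a Lipschitz
    gradient and [gamma * L ^+ 2 < 2 * eta].  Thus T is a contraction
    ([forward_backward_lipschitz]); by Fermat's rule its fixed point is the
    minimizer [zs] ([minimizer_forward_backward]).  With [n = `|z - zs|] this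
    gives [(1 - c) * n <= `|Phi z| <= (1 + c) * n] and
    [dot (Phi z) (z - zs) >= (1 - c) * n ^+ 2], and therefore the energy
    [V = n ^+ 2 / 2] obeys, along trajectories,
    [V' <= - (M1 * V `^ r1 + M2 * V `^ r2)] with [ri = (1 + pi) / 2]; the third
    term of omega adds [- D * V] when [p3 = 0] ([flow_field_decay]).

    Why the time is bounded.  If [V' <= - l V] and [G' = 1 / l], then
    [G (V s) - G (V t) >= t - s] as long as the trajectory has not arrived
    ([potential_time]).  The oscillation of [G] over all positive energies is
    then a bound on the settling time for every initial condition.  Since
    [r1 < 1 < r2], the first power makes [1 / l] integrable at 0 and the second
    one at infinity.  The three bounds of the theorem are three choices of [G]:
    powers, used separately below and above the level [V = 1]; an arctangent,
    an exact primitive for the sum of the two powers when [r1 + r2 = 2]; and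
    logarithms, which keep the linear term and whose oscillations below and
    above [V = 1] add up to exactly [Tp / Kp * predefined_gain].

    Why integral solutions suffice.  The field is continuous away from [zs], so
    by the fundamental theorem of calculus each coordinate of a trajectory is
    differentiable as long as it has not reached [zs] ([energy_derive]).  A
    trajectory that has reached [zs] never leaves it ([settled_stays]): after
    the last time spent at [zs] the energy would have to increase.  So the
    differential inequality is only used where it holds.

    Finite dimension enters through a finite family with
    [x = \sum_i dot x (e i) *: e i], which yields the existence of gradients,
    the compactness behind the existence of proximal points, and the reduction
    of the vector equation to scalar ones. *)

(** * Finite-dimensional inner product spaces *)

Section InnerProduct.
Context {R : realType} {H : normedModType R} (dot : {dot H for idfun}).
Implicit Types (x y u v w : H) (e : seq H).

Lemma dotC u v : dot u v = dot v u.
Proof. by rewrite hermC mul1r. Qed.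

Lemma dotDl u v w : dot (u + v) w = dot u w + dot v w.
Proof. exact: linearDl. Qed.

Lemma dotDr u v w : dot w (u + v) = dot w u + dot w v.
Proof. exact: linearDr. Qed.

Lemma dotNl u w : dot (- u) w = - dot u w.
Proof. exact: linearNl. Qed.

Lemma dotNr u w : dot w (- u) = - dot w u.
Proof. exact: linearNr. Qed.

Lemma dotZl (a : R) u w : dot (a *: u) w = a * dot u w.
Proof. exact: linearZl_LR. Qed.

Lemma dotZr (a : R) u w : dot w (a *: u) = a * dot w u.
Proof. exact: linearZr_LR. Qed.

Lemma dot0l w : dot 0 w = 0.
Proof. exact: linear0l. Qed.

Definition dot_simp := (dotDl, dotDr, dotNl, dotNr, dotZl, dotZr).

(** Parseval expansion: an orthonormal basis satisfies it for every [x], but the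
    identity alone carries everything that is used of such a basis. *)
Definition frame_expansion e x := x = \sum_(u <- e) dot x u *: u.

Lemma frame_expansionD e x y :
  frame_expansion e x -> frame_expansion e y -> frame_expansion e (x + y).
Proof.
rewrite /frame_expansion => hx hy; rewrite {1}hx {1}hy -big_split /=.
by apply: eq_bigr => u _; rewrite dotDl scalerDl.
Qed.

Lemma frame_expansionZ e (a : R) x :
  frame_expansion e x -> frame_expansion e (a *: x).
Proof.
rewrite /frame_expansion => hx; rewrite {1}hx scaler_sumr.
by apply: eq_bigr => u _; rewrite dotZl scalerA.
Qed.

Hypothesis hdot : induces_norm dot.

Lemma dotxx x : dot x x = `|x| ^+ 2. Proof. by rewrite hdot. Qed.

(** Cauchy-Schwarz, from [0 <= `| `|v| *: u - `|u| *: v| ^+ 2]. *)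
Lemma dot_le_norm u v : dot u v <= `|u| * `|v|.
Proof.
have [->|v0] := eqVneq v 0; first by rewrite dotC dot0l normr0 mulr0.
have nv : 0 < `|v| by rewrite normr_gt0.
have [->|u0] := eqVneq u 0; first by rewrite dot0l normr0 mul0r.
have nu : 0 < `|u| by rewrite normr_gt0.
have : 0 <= `| `|v| *: u - `|u| *: v| ^+ 2 by rewrite exprn_ge0.
rewrite hdot !dot_simp !dotxx (dotC v u) => h.
have : 0 <= 2 * (`|u| * `|v|) * (`|u| * `|v| - dot u v) by nra.
by rewrite pmulr_rge0 ?subr_ge0 // !mulr_gt0.
Qed.

Lemma norm_dot_le u v : `|dot u v| <= `|u| * `|v|.
Proof.
rewrite ler_norml dot_le_norm andbT lerNl -dotNl.
by rewrite (le_trans (dot_le_norm _ _))// normrN.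
Qed.

Lemma dotl_continuous v : continuous (fun x => dot x v).
Proof.
move=> x; apply/cvgrPdist_le => eps eps0.
have c0 : 0 < `|v| + 1 by rewrite ltr_wpDl.
near=> y; rewrite -dotNl -dotDl.
rewrite (le_trans (norm_dot_le _ _))//.
apply: (@le_trans _ _ (`|x - y| * (`|v| + 1))).
  by rewrite ler_wpM2l// lerDl.
rewrite -ler_pdivlMr//; near: y; apply: cvgr_dist_le => //.
by rewrite divr_gt0.
Unshelve. all: by end_near. Qed.

(** Adding the normalized component [r] of a new vector that is orthogonal to
    the previous ones extends the set of vectors that are expanded.  The members
    of [e] have to be expanded by [e] themselves for [r] to be orthogonal to
    them. *)
Lemma gram_schmidt n (f : 'I_n -> H) :
  exists e, {in e, forall u, frame_expansion e u} /\
            forall i, frame_expansion e (f i).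
Proof.
elim: n f => [|n IH] f; first by exists [::]; split => // -[].
have [e [he hf]] := IH (fun i => f (lift ord_max i)).
pose u := f ord_max; pose r := u - \sum_(w <- e) dot u w *: w.
have sum_split : u = \sum_(w <- e) dot u w *: w + r by rewrite /r subrKC.
have r_orth x : frame_expansion e x -> dot x r = 0.
  move=> hx; rewrite /r dotDr dotNr.
  rewrite {1}hx linear_sumlz linear_sumr /=; apply/eqP; rewrite subr_eq0.
  apply/eqP; rewrite !big_seq; apply: eq_bigr => w we.
  by rewrite !dot_simp (dotC w u) mulrC.
have frame_r x : dot x r = 0 -> frame_expansion e x ->
    frame_expansion ((`|r|^-1 *: r) :: e) x.
  move=> xr hx.
  by rewrite /frame_expansion big_cons dotZr xr mulr0 scale0r add0r.
have forall_ord (P : H -> Prop) : P u -> (forall i, P (f (lift ord_max i))) ->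
    forall i, P (f i).
  by move=> Pu Pf i; have [j ->|->] := unliftP ord_max i.
have [r0|r0] := eqVneq r 0.
  exists e; split => //; apply: (forall_ord (frame_expansion e)) => //.
  by rewrite /frame_expansion {1}sum_split r0 addr0.
have nr : `|r| != 0 by rewrite normr_eq0.
have er_r : dot r (`|r|^-1 *: r) *: (`|r|^-1 *: r) = r.
  rewrite dotZr dotxx scalerA expr2 mulrA mulVf// mul1r mulfV//.
  by rewrite scale1r.
have zero_sum : \sum_(w <- e) dot r w *: w = 0.
  rewrite big_seq big1// => w we.
  by rewrite dotC r_orth ?scale0r//; exact: he.
have hr : frame_expansion ((`|r|^-1 *: r) :: e) r.
  by rewrite /frame_expansion big_cons er_r zero_sum addr0.
exists ((`|r|^-1 *: r) :: e); split.
  move=> w; rewrite inE => /predU1P[->|we]; first exact: frame_expansionZ.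
  by apply: frame_r; [exact/r_orth/he|exact: he].
apply: (forall_ord (frame_expansion _)) => [|i]; last first.
  by apply: frame_r; [exact: r_orth|].
rewrite [X in frame_expansion _ X]sum_split.
apply: frame_expansionD => //.
have hs : frame_expansion e (\sum_(w <- e) dot u w *: w).
  rewrite big_seq; elim/big_ind : _ => [|x y|w we].
  - by rewrite /frame_expansion big1// => w _; rewrite dot0l scale0r.
  - exact: frame_expansionD.
  - by apply: frame_expansionZ; exact: he.
by apply: frame_r => //; exact: r_orth.
Qed.

Lemma finite_dimensional_frame : finite_dimensional H ->
  exists n (e : 'I_n -> H), forall x, x = \sum_(i < n) dot x (e i) *: e i.
Proof.
move=> [n [f hf]]; have [e [_ he]] := gram_schmidt n f.
exists (size e), (fun i => e`_i) => x.
rewrite -(big_mkord xpredT (fun i => dot x e`_i *: e`_i)).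
rewrite -(big_nth 0 xpredT (fun u => dot x u *: u)).
have [a ->] := hf x; apply: (big_ind (frame_expansion e)).
- by rewrite /frame_expansion big1// => w _; rewrite dot0l scale0r.
- exact: frame_expansionD.
- by move=> i _; exact: frame_expansionZ.
Qed.

End InnerProduct.

(** * Semicontinuity, compactness and gradients *)

Lemma lte_real_between {R : realType} (x y : \bar R) : (x < y)%E ->
  exists2 a : R, (x < a%:E)%E & (a%:E < y)%E.
Proof.
move: x y => [r| |] [s| |] //= rs.
- by exists ((r + s) / 2); rewrite lte_fin midf_lt.
- by exists (r + 1); rewrite ?ltry// lte_fin ltrDl.
- by exists (s - 1); rewrite ?ltNyr// lte_fin ltrBlDr ltrDl.
- by exists 0; rewrite ?ltry ?ltNyr.
Qed.

(** The sublevel sets of the values taken on [K] form a filter base on [K]; by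
    lower semicontinuity no value taken on [K] is below the value at a cluster
    point. *)
Lemma lsc_compact_min {R : realType} {T : topologicalType} (f : T -> \bar R)
    (K : set T) : compact K -> K !=set0 -> lower_semicontinuous f ->
  exists2 p, K p & forall y, K y -> (f p <= f y)%E.
Proof.
move=> cK [y0 Ky0] flsc.
pose sublevel y := K `&` [set x | (f x <= f y)%E].
have PF : ProperFilter (filter_from K sublevel).
  apply: filter_from_proper; last by move=> y Ky; exists y; split => /=.
  apply: filter_from_filter; first by exists y0.
  move=> y z Ky Kz; have [yz|zy] := leP (f y) (f z).
    by exists y => // x [Kx /= xy]; split; split => //=; exact: le_trans yz.
  exists z => // x [Kx /= xz]; split; split => //=.
  by rewrite (le_trans xz)// ltW.
have [] := cK _ PF; first by exists y0 => // x [].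
move=> p [Kp clp]; exists p => // y Ky; rewrite leNgt; apply/negP => fyp.
have [a ya ap] := lte_real_between _ _ fyp.
have [V Vp aV] := flsc p a ap.
have [x [[Kx /= xy]]] : sublevel y `&` V !=set0.
  by apply: clp => //; exists y.
by move=> /aV ax; have := lt_trans (lt_le_trans ax xy) ya; rewrite ltxx.
Qed.

(** One-sided difference quotients suffice to bound a directional derivative. *)
Lemma diff_ge {R : realType} {V : normedModType R} (h : V -> R^o) (x v : V)
    (a : R) : differentiable h x ->
  (forall t, 0 < t -> t < 1 -> a * t <= h (t *: v + x) - h x) ->
  a <= 'd h x v.
Proof.
move=> dh ha; rewrite -deriveE//.
have dv : (fun t => t^-1 *: ((h \o shift x) (t *: v) - h x)) @ 0^'+ -->
    'D_v h x.
  exact/cvg_dnbhs_at_right/(@diff_derivable _ _ _ h x v dh).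
apply: (cvgr_to_ge dv); near=> t.
rewrite /GRing.scale/= mulrC ler_pdivlMr//; apply: ha => //.
Unshelve. all: by end_near. Qed.

Section Frame.
Context {R : realType} {H : normedModType R} (dot : {dot H for idfun}).
Hypothesis hdot : induces_norm dot.
Hypothesis hfin : finite_dimensional H.

(** Riesz representation, read off the frame; it makes [gradient], defined by a
    choice, the actual gradient. *)
Lemma diff_gradient (h : H -> R^o) x v : differentiable h x ->
  'd h x v = dot (gradient dot h x) v.
Proof.
move=> dh; rewrite /gradient; set P := (X in get X).
suff /getPex : exists g, P g by apply.
have [n [e he]] := finite_dimensional_frame dot hdot hfin.
exists (\sum_(i < n) 'd h x (e i) *: e i) => w.
rewrite {1}(he w) linear_sum linear_sumlz; apply: eq_bigr => i _ /=.
by rewrite linearZ_LR linearZl_LR /= (dotC _ (e i)) [LHS]mulrC.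
Qed.

(** A ball is contained in the image of a box of coordinates, since the
    coordinates of a frame expansion are inner products and hence bounded. *)
Lemma bounded_sub_compact (c : H) (r : R) :
  exists2 K, compact K & forall x, `|x - c| <= r -> K x.
Proof.
have [n [e he]] := finite_dimensional_frame dot hdot hfin.
pose T (a : 'rV[R]_n) := c + \sum_(i < n) a ord0 i *: e i.
pose box i : set R := `[- (r * `|e i|), r * `|e i|]%classic.
pose A := [set a : 'rV[R]_n | forall i, box i (a ord0 i)].
exists (T @` A).
  apply: continuous_compact; last first.
    by apply: (@rV_compact R n box) => i; exact: segment_compact.
  have cT : continuous T.
    move=> a; apply: (@continuousD _ _ _ (cst c)); first exact: cst_continuous.
    have Fa := nbhs_filter a.
    apply: (@cvg_big _ _ +%R) => [z|i _].
      by apply: cvgD; [exact: cvg_fst|exact: cvg_snd].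
    apply: (@continuousZr_tmp _ _ _ (fun a : 'rV[R]_n => a ord0 i)).
    exact: coord_continuous.
  exact: continuous_subspaceT.
move=> x xr; exists (\row_i dot (x - c) (e i)) => [i|]; last first.
  rewrite /T; under eq_bigr do rewrite mxE.
  by rewrite -he subrKC.
rewrite mxE /box/= in_itv/= -ler_norml (le_trans (norm_dot_le _ hdot _ _))//.
by rewrite ler_wpM2r.
Qed.

End Frame.

(** * Subgradients and proximal points *)

Lemma lsc_add_continuous {R : realType} {T : topologicalType}
    (f : T -> \bar R) (q : T -> R) : lower_semicontinuous f -> continuous q ->
  lower_semicontinuous (fun x => f x + (q x)%:E)%E.
Proof.
move=> flsc cq x a; rewrite -lteBlDr// -EFinB => /lte_real_between[b].
rewrite lte_fin => qb /flsc[V xV Vb].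
exists (V `&` [set y | a - b < q y]).
  by apply: filterI => //; apply: (cvgr_gt _ (cq x)); move: qb; lra.
move=> y [/Vb yb /= qy]; rewrite -lteBlDr// -EFinB (le_lt_trans _ yb)// lee_fin.
by move: qy; lra.
Qed.

Lemma le_of_le_addM {R : realFieldType} (a b c : R) : 0 <= c ->
  (forall t, 0 < t -> t < 1 -> a <= b + t * c) -> a <= b.
Proof.
move=> c0 h; rewrite leNgt; apply/negP => ba.
have den : 0 < 2 * (c + (a - b)) by lra.
(* this [t] is below 1 and [t * c < a - b] *)
have := h ((a - b) / (2 * (c + (a - b)))).
rewrite divr_gt0 ?subr_gt0// ltr_pdivrMr// => /(_ isT) /(_ _)/wrap[]; first lra.
rewrite mulrAC -lerBlDl ler_pdivlMr//; apply/negP; rewrite -ltNge.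
by nra.
Qed.

Section Prox.
Context {R : realType} {H : normedModType R} (dot : {dot H for idfun}).
Hypothesis hdot : induces_norm dot.
Hypothesis hfin : finite_dimensional H.

Lemma normBsq (u v : H) : `|u - v| ^+ 2 = `|u| ^+ 2 - 2 * dot u v + `|v| ^+ 2.
Proof. by rewrite !hdot !(dot_simp dot) (dotC _ v u); ring. Qed.

Definition is_subgradient (phi : H -> \bar R) (x g : H) :=
  phi x \is a fin_num /\ forall u, (phi x + (dot g (u - x))%:E <= phi u)%E.

Lemma subgradient_monotone phi x y g k :
  is_subgradient phi x g -> is_subgradient phi y k -> 0 <= dot (g - k) (x - y).
Proof.
move=> [fx hx] [fy hy]; have := hx y; have := hy x.
rewrite -(fineK fx) -(fineK fy) -!EFinD !lee_fin !(dot_simp dot); lra.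
Qed.

Variable phi : H -> \bar R.
Hypothesis phi_proper : proper_function phi.
Hypothesis phi_conv : ereal_convex phi.

(** Compare [w] with points of the segment from [w] to [u] and use convexity of
    [phi] there: the first-order condition for minimizing [phi + q], before any
    limit is taken, so that it serves both for a differentiable [q] and for the
    quadratic term of the proximal objective. *)
Lemma minimizer_slope (q : H -> R) w :
  is_minimizer (fun u => phi u + (q u)%:E)%E w ->
  phi w \is a fin_num /\
  forall u, phi u \is a fin_num -> forall t, 0 < t -> t < 1 ->
    (fine (phi w) - fine (phi u)) * t <= q (t *: (u - w) + w) - q w.
Proof.
move: phi_proper => [phiNy [x0 x0y]] wmin.
have fw : phi w \is a fin_num.
  rewrite fin_numE phiNy /=; apply: contraTN isT => /eqP wy.
  have := wmin x0; rewrite wy addye// leye_eq => /eqP.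
  by move: (phi x0) x0y => [].
split => // u fu t t0 t1.
have conv := phi_conv u w t (ltW t0) (ltW t1).
have -> : t *: (u - w) + w = t *: u + (1 - t) *: w.
  by rewrite scalerBr scalerBl scale1r -addrA (addrC (- _)).
have := wmin (t *: u + (1 - t) *: w).
move: conv; set p := t *: u + _; rewrite -(fineK fw) -(fineK fu).
rewrite -!EFinM -EFinD.
move: (phi p) (phiNy p) => [r| |]//= _; rewrite -!EFinD !lee_fin; lra.
Qed.

Lemma fermat_subgradient (h : H -> R^o) x : differentiable h x ->
  is_minimizer (fun z => (h z)%:E + phi z)%E x ->
  is_subgradient phi x (- gradient dot h x).
Proof.
move=> dh xmin; have [|fx hx] := @minimizer_slope h x.
  by move=> u; rewrite addeC [leRHS]addeC; exact: xmin.
split => // u; have [fu|] := boolP (phi u \is a fin_num); last first.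
  by rewrite fin_numE (phi_proper.1 u)/= negbK => /eqP ->; rewrite leey.
rewrite -(fineK fx) -(fineK fu) -EFinD lee_fin.
have := diff_ge _ _ _ _ dh (hx u fu).
by rewrite (diff_gradient dot)// (dotNl dot); lra.
Qed.

Variable gamma : R.
Hypothesis gamma_gt0 : 0 < gamma.

Let objective z u := (phi u + ((2 * gamma)^-1 * `|z - u| ^+ 2)%:E)%E.

(** An affine minorant of [phi] makes the proximal objective coercive: outside
    an explicit ball around [x] its values are at least the one at [x], so that
    a minimum over a compact set containing the ball is global. *)
Lemma prox_objective_min (phi_lsc : lower_semicontinuous phi) x g z :
  is_subgradient phi x g -> exists w, is_minimizer (objective z) w.
Proof.
move=> [fx hx].
have obj_lsc : lower_semicontinuous (objective z).
  apply: lsc_add_continuous => // u.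
  apply: cvgM; first exact: cvg_cst.
  apply: (@cvg_comp _ _ _ (fun u => `|z - u|) (fun t : R => t ^+ 2)).
    by apply: cvg_norm; apply: cvgB; [exact: cvg_cst|exact: cvg_id].
  exact: exprn_continuous.
have [K cK hK] := bounded_sub_compact dot hdot hfin x
  (2 * `|z - x| + 2 * gamma * `|g|).
have Kx : K x.
  by apply: hK; rewrite subrr normr0 addr_ge0// !mulr_ge0// ltW.
have [p Kp pmin] :=
  lsc_compact_min (objective z) K cK (ex_intro _ x Kx) obj_lsc.
exists p => u; have [/hK|far] := leP `|u - x| (2 * `|z - x| + 2 * gamma * `|g|).
  exact: pmin.
apply: (le_trans (pmin _ Kx)); rewrite /objective.
apply: (@le_trans _ _ (phi x + (dot g (u - x))%:E +
    ((2 * gamma)^-1 * `|z - u| ^+ 2)%:E)%E); last exact: leeD2r.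
rewrite -(fineK fx) -!EFinD lee_fin -addrA lerD2l.
have -> : z - u = (z - x) - (u - x) by rewrite opprB addrA subrK.
rewrite [in leRHS]normBsq.
have := norm_dot_le dot hdot g (u - x); rewrite ler_norml => /andP[gd _].
have zd := dot_le_norm dot hdot (z - x) (u - x).
move: gd zd far; set D := `|z - x|; set d := `|u - x|; set G := `|g|.
move=> gd zd far.
rewrite -(ler_pM2l (_ : 0 < 2 * gamma)); last by rewrite mulr_gt0.
rewrite mulrDr !mulrA !mulfV ?gt_eqF ?mulr_gt0// !mul1r.
have d0 : 0 <= d by exact: normr_ge0.
have : 2 * gamma * - (G * d) <= 2 * gamma * dot g (u - x).
  by rewrite ler_pM2l// mulr_gt0.
have : 0 <= d * (d - (2 * D + 2 * gamma * G)).
  by rewrite mulr_ge0// subr_ge0 ltW.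
by nra.
Qed.

Lemma prox_min_subgradient z w :
  is_minimizer (objective z) w -> is_subgradient phi w (gamma^-1 *: (z - w)).
Proof.
move=> wmin.
have [fw hw] :=
  minimizer_slope (fun u => (2 * gamma)^-1 * `|z - u| ^+ 2) w wmin.
split => // u; have [fu|] := boolP (phi u \is a fin_num); last first.
  by rewrite fin_numE (phi_proper.1 u)/= negbK => /eqP ->; rewrite leey.
rewrite -(fineK fw) -(fineK fu) -EFinD lee_fin (dotZl dot).
set v := u - w.
suff : fine (phi w) - fine (phi u) <= - (gamma^-1 * dot (z - w) v) by lra.
have k0 : 0 < (2 * gamma)^-1 by rewrite invr_gt0 mulr_gt0.
apply: (@le_of_le_addM _ _ _ ((2 * gamma)^-1 * `|v| ^+ 2)).
  by rewrite mulr_ge0 ?exprn_ge0// ltW.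
move=> t t0 t1; have := hw u fu t t0 t1; rewrite -/v.
have -> : z - (t *: v + w) = (z - w) - t *: v by rewrite opprD addrA addrAC.
rewrite normBsq normrZ (dotZr dot) exprMn (gtr0_norm t0).
have -> : gamma^-1 = 2 * (2 * gamma)^-1.
  by rewrite invfM mulrA mulfV// mul1r.
move: (2 * gamma)^-1 k0 => k k0 ht.
by rewrite -(ler_pM2r t0); nra.
Qed.

End Prox.

(** * The forward-backward operator *)

Section ForwardBackward.
Context {R : realType} {H : normedModType R} (dot : {dot H for idfun}).
Hypothesis hdot : induces_norm dot.
Hypothesis hfin : finite_dimensional H.
Context (phi : H -> \bar R) (gamma : R).
Hypothesis phi_proper : proper_function phi.
Hypothesis phi_conv : ereal_convex phi.
Hypothesis phi_lsc : lower_semicontinuous phi.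
Hypothesis gamma_gt0 : 0 < gamma.
Context (x0 g0 : H).
Hypothesis phi_minorant : is_subgradient dot phi x0 g0.

Lemma prox_subgradient z :
  is_subgradient dot phi (prox gamma phi z)
    (gamma^-1 *: (z - prox gamma phi z)).
Proof.
apply: prox_min_subgradient => //; rewrite /prox; set P := (X in get X).
have /getPex// : exists w, P w.
exact: (prox_objective_min _ hdot hfin _ _ gamma_gt0 phi_lsc _ _ _
  phi_minorant).
Qed.

(** Monotonicity of subgradients at the two proximal points reads
    [`|w - w'| ^+ 2 <= dot (z - z') (w - w')]. *)
Lemma prox_nonexpansive z z' :
  `|prox gamma phi z - prox gamma phi z'| <= `|z - z'|.
Proof.
have := subgradient_monotone _ _ _ _ _ _
  (prox_subgradient z) (prox_subgradient z').
set w := prox gamma phi z; set w' := prox gamma phi z'.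
rewrite -scalerBr (dotZl dot) pmulr_rge0 ?invr_gt0//.
have -> : z - w - (z' - w') = (z - z') - (w - w').
  by rewrite !opprD !opprK addrACA.
rewrite (dotDl dot) (dotNl dot) subr_ge0 -hdot => h.
have [->|ww] := eqVneq (w - w') 0; first by rewrite normr0.
have nw : 0 < `|w - w'| by rewrite normr_gt0.
by rewrite -(ler_pM2r nw) -expr2 (le_trans h)// dot_le_norm.
Qed.

(** Converse of [prox_subgradient]: the inclusion characterizes the proximal
    point, again by monotonicity. *)
Lemma prox_of_subgradient x g :
  is_subgradient dot phi x g -> prox gamma phi (x + gamma *: g) = x.
Proof.
move=> hx; have := subgradient_monotone _ _ _ _ _ _
  (prox_subgradient (x + gamma *: g)) hx.
set p := prox _ _ _.
have -> : gamma^-1 *: (x + gamma *: g - p) - g = - (gamma^-1 *: (p - x)).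
  rewrite addrAC scalerDr scalerA mulVf ?gt_eqF// scale1r addrK.
  by rewrite -scalerN opprB.
rewrite (dotNl dot) (dotZl dot) -hdot oppr_ge0 pmulr_rle0 ?invr_gt0// => px.
apply/eqP; rewrite -subr_eq0 -normr_eq0 -sqrf_eq0 eq_le px /=.
by rewrite exprn_ge0.
Qed.

Context (h : H -> R^o) (eta L : R).
Hypothesis hstrong : strongly_convex dot eta h.
Hypothesis L_gt0 : 0 < L.
Hypothesis hlip : L.-lipschitz (gradient dot h).
Hypothesis hgamma : gamma * L ^+ 2 < 2 * eta.

(** The gradient step multiplies squared distances by at most [q < 1].  This [q]
    may vanish, or be negative when [H] is trivial; [Num.sqrt] maps negative
    numbers to 0 and the maximum with [2^-1] makes the constant positive. *)
Lemma forward_backward_lipschitz :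
  exists2 c, 0 < c < 1 & c.-lipschitz (forward_backward dot h phi gamma).
Proof.
pose q := 1 - 2 * gamma * eta + (gamma * L) ^+ 2.
exists (Num.max 2^-1 (Num.sqrt q)).
  rewrite lt_max invr_gt0 ltr0n/= gt_max invf_lt1 ?ltr1n// andTb.
  rewrite -[ltRHS]sqrtr1 ltr_sqrt// /q exprMn.
  have : gamma * (gamma * L ^+ 2) < gamma * (2 * eta) by rewrite ltr_pM2l.
  by rewrite expr2 -subr_gt0 => ?; lra.
move=> [z w] _ /=.
rewrite (le_trans (prox_nonexpansive _ _))//.
set u := gradient dot h z; set v := gradient dot h w.
have -> : z - gamma *: u - (w - gamma *: v) = (z - w) - gamma *: (u - v).
  by rewrite scalerBr !opprD !opprK addrACA.
have sc : eta * `|z - w| ^+ 2 <= dot (u - v) (z - w) by exact: hstrong.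
have lip : `|u - v| <= L * `|z - w| by exact: (hlip (z, w)).
apply: (@le_trans _ _ (Num.sqrt q * `|z - w|)); last first.
  by rewrite ler_wpM2r// le_max lexx orbT.
rewrite -ler_sqr ?nnegrE ?mulr_ge0// ?sqrtr_ge0// exprMn.
apply: (@le_trans _ _ (q * `|z - w| ^+ 2)); last first.
  rewrite ler_wpM2r ?exprn_ge0//; have [q0|q0] := leP 0 q.
    by rewrite sqr_sqrtr.
  by rewrite (le_trans (ltW q0))// exprn_ge0// sqrtr_ge0.
rewrite (normBsq dot hdot (z - w)) normrZ (gtr0_norm gamma_gt0).
rewrite (dotZr dot) (dotC dot).
have lip2 : `|u - v| ^+ 2 <= L ^+ 2 * `|z - w| ^+ 2.
  by rewrite -exprMn lerXn2r ?nnegrE ?mulr_ge0 ?(ltW L_gt0).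
have : gamma ^+ 2 * `|u - v| ^+ 2 <= gamma ^+ 2 * (L ^+ 2 * `|z - w| ^+ 2).
  by rewrite ler_wpM2l// exprn_ge0// ltW.
have : gamma * (eta * `|z - w| ^+ 2) <= gamma * dot (u - v) (z - w).
  by rewrite ler_pM2l.
by rewrite /q !exprMn; lra.
Qed.

Lemma minimizer_forward_backward zs : differentiable h zs ->
  is_minimizer (fun z => (h z)%:E + phi z)%E zs ->
  forward_backward dot h phi gamma zs = zs.
Proof.
move=> dh zsmin; rewrite /forward_backward -scalerN.
exact/prox_of_subgradient/fermat_subgradient.
Qed.

End ForwardBackward.

(** * Trajectories and their energy *)

Lemma half_sqr_derive {R : realType} (c r : R) :
  is_derive r 1 (fun s : R => (s - c) ^+ 2 / 2) (r - c).
Proof.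
have -> : (fun s : R => (s - c) ^+ 2 / 2) = 2^-1 \*: (id - cst c) ^+ 2.
  by apply/funext => s; rewrite /= [RHS]mulrC.
apply: is_derive_eq; rewrite /GRing.scale/= subr0 !mulr1 mulrA mulVf// mul1r.
by [].
Qed.

Section Solutions.
Context {R : realType} {H : normedModType R} (dot : {dot H for idfun}).
Hypothesis hdot : induces_norm dot.
Hypothesis hfin : finite_dimensional H.
Context (F : H -> H) (zs : H).

Definition energy (x : H) : R := `|x - zs| ^+ 2 / 2.

Context (z : R -> H).
Hypothesis hz : is_solution dot F z.

Lemma solution_coord_within v T : 0 <= T ->
  {within `[0, T], continuous (fun t => dot (z t) v)}.
Proof.
move=> T0.
pose I (t : R) := dot (z 0) v +
  parameterized_integral lebesgue_measure 0 t (fun s => dot (F (z s)) v).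
have cI : {within `[0, T], continuous I}.
  apply: (@within_continuousD _ _ _ _ (fun=> dot (z 0) v)).
    exact/continuous_subspaceT/cst_continuous.
  apply: parameterized_integral_continuous => //.
  by have [] := hz T v T0.
apply: (subspace_eq_continuous _ cI) => t.
rewrite inE/= in_itv/= => /andP[t0 _].
by have [_ E] := hz t v t0; rewrite /from_subspace E.
Qed.

Lemma solution_coord_continuous v t : 0 < t ->
  {for t, continuous (fun t => dot (z t) v)}.
Proof.
move=> t0; have T0 : 0 <= t + 1 by rewrite addr_ge0// ltW.
apply: (within_continuous_continuous _ (solution_coord_within v _ T0)).
  by rewrite ltr_wpDr.
by rewrite in_itv/= t0 ltrDl ltr01.
Qed.

Lemma solution_continuous t : 0 < t -> {for t, continuous z}.
Proof.
move=> t0; have [n [e he]] := finite_dimensional_frame dot hdot hfin.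
have -> : z = fun s => \sum_(i < n) dot (z s) (e i) *: e i.
  by apply/funext => s; exact: he.
have Ft := nbhs_filter t.
apply: (@cvg_big _ _ +%R) => [x|i _].
  by apply: cvgD; [exact: cvg_fst|exact: cvg_snd].
by apply: (@continuousZr_tmp _ _ _ (fun s => dot (z s) (e i)));
  exact: solution_coord_continuous.
Qed.

(** The fundamental theorem of calculus, at points where the field is continuous
    along the trajectory. *)
Lemma solution_coord_derive v t : 0 < t -> {for z t, continuous F} ->
  is_derive t 1 (fun t => dot (z t) v) (dot (F (z t)) v).
Proof.
move=> t0 cF; have T0 : 0 <= t + 1 by rewrite addr_ge0// ltW.
have [intF _] := hz (t + 1) v T0.
have cf : {for t, continuous (fun s => dot (F (z s)) v)}.
  apply: (@continuous_comp _ _ _ z (fun x => dot (F x) v)).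
    exact: solution_continuous.
  apply: (@continuous_comp _ _ _ F (fun x => dot x v)) => //.
  exact: dotl_continuous.
have [] := @continuous_FTC1_closed R (fun s => dot (F (z s)) v) 0 t (t + 1)
  _ intF t0 cf.
  by rewrite ltrDl.
set I := (fun x => _) => dI Iv.
have : is_derive t 1 (fun s => dot (z 0) v + I s) (dot (F (z t)) v).
  rewrite -[X in is_derive _ _ _ X]add0r -Iv derive1E.
  apply: (@is_deriveD _ _ _ (fun=> dot (z 0) v)); exact/derivableP.
apply: near_eq_is_derive; near=> s.
have s0 : 0 <= s by apply/ltW; near: s; exact: lt_nbhsr.
by have [_ ->] := hz s v s0.
Unshelve. all: by end_near. Qed.

Lemma energy_frame n (e : 'I_n -> H) :
  (forall x, x = \sum_(i < n) dot x (e i) *: e i) ->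
  energy \o z = fun t => \sum_(i < n) (dot (z t) (e i) - dot zs (e i)) ^+ 2 / 2.
Proof.
move=> he; apply/funext => t; rewrite /energy/= -mulr_suml; congr (_ / _).
rewrite hdot {1}(he (z t - zs)) linear_sumlz; apply: eq_bigr => i _ /=.
by rewrite (dotZl dot) (dotC dot (e i)) (dotDl dot) (dotNl dot) expr2.
Qed.

Lemma energy_within T : 0 <= T -> {within `[0, T], continuous (energy \o z)}.
Proof.
move=> T0; have [n [e he]] := finite_dimensional_frame dot hdot hfin.
rewrite (energy_frame _ _ he); apply: (@continuous_big _ _ +%R) => [x|i _ t].
  by apply: cvgD; [exact: cvg_fst|exact: cvg_snd].
apply: (@continuous_comp _ _ _ (fun t : subspace `[0, T] => dot (z t) (e i))
  (fun r : R => (r - dot zs (e i)) ^+ 2 / 2)).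
  exact: (solution_coord_within (e i) _ T0).
have dg : is_derive (dot (z t) (e i)) 1
    (fun r : R => (r - dot zs (e i)) ^+ 2 / 2) (dot (z t) (e i) - dot zs (e i)).
  exact: half_sqr_derive.
exact/differentiable_continuous/derivable1_diffP.
Qed.

Lemma energy_derive t : 0 < t -> {for z t, continuous F} ->
  is_derive t 1 (energy \o z) (dot (F (z t)) (z t - zs)).
Proof.
move=> t0 cF; have [n [e he]] := finite_dimensional_frame dot hdot hfin.
rewrite (energy_frame _ _ he).
have -> : dot (F (z t)) (z t - zs) =
    \sum_(i < n) (dot (z t) (e i) - dot zs (e i)) * dot (F (z t)) (e i).
  rewrite {1}(he (z t - zs)) linear_sumr /=; apply: eq_bigr => i _.
  by rewrite (dotZr dot) (dotDl dot) (dotNl dot).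
rewrite -fct_sumE; apply: is_derive_sum => i.
apply: (@is_derive1_comp _ (fun r : R => (r - dot zs (e i)) ^+ 2 / 2)
  (fun t => dot (z t) (e i))); first exact: half_sqr_derive.
exact: solution_coord_derive.
Qed.

End Solutions.

(** * Decrease of potentials of the energy *)

Section Lyapunov.
Context {R : realType} {H : normedModType R} (dot : {dot H for idfun}).
Hypothesis hdot : induces_norm dot.
Hypothesis hfin : finite_dimensional H.
Context (F : H -> H) (zs : H).
Hypothesis F_cont : forall x, x != zs -> {for x, continuous F}.
Hypothesis F_dissip : forall x, x != zs -> dot (F x) (x - zs) <= 0.

Let E := energy zs.

Lemma energy_ge0 x : 0 <= E x.
Proof. by rewrite divr_ge0// exprn_ge0. Qed.

Lemma energy0 : E zs = 0.
Proof. by rewrite /E /energy subrr normr0 expr0n mul0r. Qed.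

Lemma energy_gt0 x : (0 < E x) = (x != zs).
Proof.
rewrite /E /energy pmulr_lgt0 ?invr_gt0// exprn_even_gt0//=.
by rewrite normr_eq0 subr_eq0.
Qed.

Section Trajectory.
Context (z : R -> H).
Hypothesis hz : is_solution dot F z.

(** Mean value theorem for [G (E (z t))].  The trajectory may sit at [zs] at the
    end points [s] and [t], where only continuity is available; this is what
    [settled_stays] requires. *)
Lemma potential_decrease (G g : R -> R) (k s t : R) : 0 <= s -> s <= t ->
  (forall u, s < u < t -> z u != zs) ->
  (forall u, s <= u <= t -> {for E (z u), continuous G}) ->
  (forall v : R, 0 < v -> is_derive v 1 G (g v)) ->
  (forall x, x != zs -> g (E x) * dot (F x) (x - zs) <= - k) ->
  k * (t - s) <= G (E (z s)) - G (E (z t)).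
Proof.
move=> s0 st zne cG dG gk.
pose w u := g (E (z u)) * dot (F (z u)) (z u - zs).
have dW u : u \in `]s, t[ -> is_derive u 1 (G \o (E \o z)) (w u).
  rewrite in_itv/= => sut; have zu := zne u sut.
  apply: is_derive1_comp; first by apply: dG; rewrite energy_gt0.
  apply: energy_derive => //; last exact: F_cont.
  by case/andP: sut => su _; exact: le_lt_trans su.
have cE : {within `[s, t], continuous (E \o z)}.
  apply: (continuous_subspaceW _ (energy_within _ hdot hfin _ _ _ hz t _)).
    by apply: subset_itvr; rewrite bnd_simp.
  exact: le_trans st.
have cW : {within `[s, t], continuous (G \o (E \o z))}.
  apply: within_continuous_comp => // r; rewrite inE => -[u /= + <-].
  by rewrite in_itv; exact: cG.
move: st; rewrite le_eqVlt => /predU1P[->|st]; first by rewrite !subrr mulr0.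
have [c cst /= Ec] := MVT st dW cW.
rewrite -[leRHS]opprB Ec -mulNr ler_wpM2r ?subr_ge0 ?(ltW st)// lerNr gk//.
by apply: zne; rewrite in_itv in cst.
Qed.

(** Take the last time before [t] spent at [zs]: after it the trajectory is away
    from [zs], so its energy decreases from 0. *)
Lemma settled_stays s t : 0 <= s -> s <= t -> z s = zs -> z t = zs.
Proof.
move=> s0 st zsE; apply: contrapT => /eqP zt.
pose A := [set u | s <= u <= t /\ z u = zs].
have As : A s by split; rewrite ?lexx.
have supA : has_sup A by split; [exists s|exists t => u [/andP[]]].
have sA : s <= sup A by exact: (ub_le_sup supA.2).
have At : sup A <= t by apply: ge_sup => [|u [/andP[]]//]; exists s.
have zA : z (sup A) = zs.
  apply: contrapT => /eqP zA.
  have sltA : s < sup A.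
    by rewrite lt_neqAle sA andbT; apply: contra_neq zA => <-.
  have A0 : 0 < sup A by exact: le_lt_trans sltA.
  have : \forall u \near sup A, z u != zs.
    have cz : z u - zs @[u --> sup A] --> z (sup A) - zs.
      apply: cvgB; last exact: cvg_cst.
      exact: (solution_continuous _ hdot hfin _ _ hz _ A0).
    have zA' : z (sup A) - zs != 0 by rewrite subr_eq0.
    by apply: filterS (cvgr_neq0 _ cz zA') => u; rewrite subr_eq0.
  case/nbhs_ballP => d d0 hd.
  have [u Au ud] := sup_adherent d0 supA.
  have : z u != zs.
    apply: hd; rewrite /ball/= ger0_norm ?subr_ge0 ?(ub_le_sup supA.2)//.
    by rewrite ltrBlDr addrC -ltrBlDr.
  by rewrite Au.2 eqxx.
have At' : sup A < t.
  by rewrite lt_neqAle At andbT; apply: contra_neq zt => <-.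
have := potential_decrease id (fun=> 1) 0 (sup A) t.
rewrite mul0r zA energy0 sub0r oppr_ge0 => h.
suff : E (z t) <= 0 by rewrite leNgt energy_gt0 zt.
apply: h => //; first exact: le_trans sA.
- move=> u /andP[Au ut]; apply/eqP => zu.
  suff : u <= sup A by rewrite leNgt Au.
  apply: (ub_le_sup supA.2).
  by split => //; rewrite (le_trans sA (ltW Au)) ltW.
- by move=> u _; exact: cvg_id.
- by move=> x xzs; rewrite mul1r oppr0; exact: F_dissip.
Qed.

Lemma unsettled_before s t : 0 <= s -> s <= t -> z t != zs -> z s != zs.
Proof. by move=> s0 st; apply: contra_neq; exact: settled_stays. Qed.

Lemma energy_antitone s t : 0 <= s -> s <= t -> E (z t) <= E (z s).
Proof.
move=> s0 st; have [->|zt] := eqVneq (z t) zs.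
  by rewrite energy0 energy_ge0.
have := potential_decrease id (fun=> 1) 0 s t s0 st.
rewrite mul0r subr_ge0; apply.
- move=> u /andP[su /ltW ut]; apply: unsettled_before ut zt.
  exact: le_trans (ltW su).
- by move=> u _; exact: cvg_id.
- by move=> x xzs; rewrite mul1r oppr0; exact: F_dissip.
Qed.

(** Separation of variables in [V' <= - l V], with [G] a primitive of
    [1 / l]. *)
Lemma potential_time (G l : R -> R) s t u : 0 <= s -> s <= t -> t <= u ->
  z u != zs ->
  (forall v : R, 0 < v -> 0 < l v) ->
  (forall v : R, 0 < v -> is_derive v 1 G (l v)^-1) ->
  (forall x, x != zs -> dot (F x) (x - zs) <= - l (E x)) ->
  t - s <= G (E (z s)) - G (E (z t)).
Proof.
move=> s0 st tu zu l0 dG Fl; rewrite -[leLHS]mul1r.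
have zne r : s <= r <= t -> z r != zs.
  move=> /andP[sr rt]; apply: (unsettled_before _ u) => //.
    exact: le_trans sr.
  exact: le_trans tu.
apply: (potential_decrease G (fun v => (l v)^-1)) => //
  [r /andP[sr rt]|r rst|x xzs].
- by apply: zne; rewrite !ltW.
- have Er : 0 < E (z r) by rewrite energy_gt0 zne.
  have := dG _ Er => dGr.
  exact/differentiable_continuous/derivable1_diffP.
- have Ex : 0 < E x by rewrite energy_gt0.
  by rewrite mulrC ler_pdivrMr ?l0// mulN1r Fl.
Qed.

End Trajectory.

End Lyapunov.

(** * Primitives of the inverse decay rates *)

Section Potentials.
Context {R : realType}.
Implicit Types a d r v M : R.

Lemma pow_potential_derive M r v : 0 < M -> r != 1 -> 0 < v ->
  is_derive v 1 (fun v => v `^ (1 - r) / (M * (1 - r))) (M * v `^ r)^-1.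
Proof.
move=> M0 r1 v0.
have -> : (fun v => v `^ (1 - r) / (M * (1 - r))) =
    (M * (1 - r))^-1 \*: (fun u => u `^ (1 - r)).
  by apply/funext => u; rewrite /= mulrC.
have dp := @is_derive1_powR R (1 - r) v v0.
apply: is_derive_eq; rewrite /GRing.scale/= addrAC subrr add0r powRN.
have r1' : 1 - r != 0 by rewrite subr_eq0 eq_sym.
have vr : v `^ r != 0 by rewrite gt_eqF// powR_gt0.
by field; rewrite r1' vr gt_eqF.
Qed.

Lemma log_potential_derive a d r v : 0 < a -> 0 < d -> r != 1 -> 0 < v ->
  is_derive v 1 (fun v => ln (1 + d / a * v `^ (1 - r)) / (d * (1 - r)))
    (a * v `^ r + d * v)^-1.
Proof.
move=> a0 d0 r1 v0.
pose w := (cst 1 + (d / a) \*: (fun u => u `^ (1 - r))) : R -> R.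
have -> : (fun v => ln (1 + d / a * v `^ (1 - r)) / (d * (1 - r))) =
    (d * (1 - r))^-1 \*: (@ln R \o w).
  by apply/funext => u; rewrite /= mulrC.
have dp := @is_derive1_powR R (1 - r) v v0.
have w0 : 0 < w v by rewrite addr_gt0// mulr_gt0 ?divr_gt0 ?powR_gt0.
have dw : is_derive v 1 w (0 + d / a * ((1 - r) * v `^ (1 - r - 1))).
  exact: is_deriveD.
have dl := is_derive1_comp (is_derive1_ln w0) dw.
apply: is_derive_eq; rewrite /GRing.scale/=.
have vr : 0 < v `^ r by rewrite powR_gt0.
have vr1 : v `^ (1 - r) = v / v `^ r.
  by rewrite powRB ?powRr1 ?(ltW v0)// (gt_eqF v0) implybT.
have -> : w v = 1 + d / a * (v / v `^ r) by rewrite -vr1.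
have -> : v `^ (1 - r - 1) = (v `^ r)^-1 by rewrite addrAC subrr add0r powRN.
have r1' : 1 - r != 0 by rewrite subr_eq0 eq_sym.
by field; rewrite r1' !gt_eqF// ?addr_gt0 ?mulr_gt0//.
Qed.

(** The substitution [u = v `^ (2 * alpha)^-1] turns the integral of the inverse
    rate into that of [2 * alpha / (M1 + M2 * u ^+ 2)]. *)
Lemma atan_potential_derive M1 M2 alpha v : 0 < M1 -> 0 < M2 -> 0 < alpha ->
  0 < v ->
  is_derive v 1 (fun v => 2 * alpha / Num.sqrt (M1 * M2) *
      atan (Num.sqrt (M1 * M2) / M1 * v `^ (2 * alpha)^-1))
    (M1 * v `^ (1 - (2 * alpha)^-1) + M2 * v `^ (1 + (2 * alpha)^-1))^-1.
Proof.
move=> M10 M20 al0 v0; set s := Num.sqrt _; set b := (2 * alpha)^-1.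
have s0 : 0 < s by rewrite sqrtr_gt0 mulr_gt0.
have s2 : s ^+ 2 = M1 * M2 by rewrite sqr_sqrtr// mulr_ge0// ltW.
have b0 : 0 < b by rewrite invr_gt0 mulr_gt0.
pose w := ((s / M1) \*: (fun u => u `^ b)) : R -> R.
have -> : (fun v => 2 * alpha / s * atan (s / M1 * v `^ b)) =
  (2 * alpha / s) \*: (@atan R \o w) by [].
have dp := @is_derive1_powR R b v v0.
have dw : is_derive v 1 w (s / M1 * (b * v `^ (b - 1))).
  exact: is_deriveZ.
have dl := is_derive1_comp (is_derive1_atan (w v)) dw.
apply: is_derive_eq; rewrite /GRing.scale/=.
have vb : 0 < v `^ b by rewrite powR_gt0.
have -> : v `^ (1 - b) = v / v `^ b.
  by rewrite powRB ?powRr1 ?(ltW v0)// (gt_eqF v0) implybT.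
have -> : v `^ (b - 1) = v `^ b / v.
  by rewrite powRB ?powRr1 ?(ltW v0)// (gt_eqF v0) implybT.
have -> : v `^ (1 + b) = v * v `^ b.
  by rewrite powRD ?powRr1 ?(ltW v0)// (gt_eqF v0) implybT.
have -> : 2 * alpha = b^-1 by rewrite /b invrK.
have -> : w v = s / M1 * v `^ b by [].
rewrite exprMn expr_div_n s2.
by field; rewrite !gt_eqF// ?addr_gt0 ?mulr_gt0//.
Qed.

End Potentials.

(** * Settling times from decay rates *)

Section Settling.
Context {R : realType} {H : normedModType R} (dot : {dot H for idfun}).
Hypothesis hdot : induces_norm dot.
Hypothesis hfin : finite_dimensional H.
Context (F : H -> H) (zs : H).
Hypothesis F_cont : forall x, x != zs -> {for x, continuous F}.
Hypothesis F_dissip : forall x, x != zs -> dot (F x) (x - zs) <= 0.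
Hypothesis F_eq : equilibrium F zs.

Let E := energy zs.

Lemma dissipative_lyapunov_stable : lyapunov_stable dot F zs.
Proof.
have bE (x y : H) e : ball x e y <-> `|y - x| < e.
  by rewrite -ball_normE/= distrC.
split => // eps eps0; exists eps => // z hz /bE z0 t t0.
apply/bE; rewrite (le_lt_trans _ z0)//.
have := energy_antitone _ hdot hfin _ _ F_cont F_dissip _ hz _ _
  (lexx 0) (ltW t0).
by rewrite /energy ler_pM2r ?invr_gt0// ler_sqr ?nnegrE.
Qed.

Lemma settles_within_of_bound (T : R) : 0 <= T ->
  (forall z, is_solution dot F z -> forall t, 0 <= t -> z t != zs -> t < T) ->
  settles_within dot F zs T.
Proof.
move=> T0 hT z hz; apply: ereal_inf_lbound; exists T => //; split => // t Tt.
apply: contrapT => /eqP zt; move: (hT z hz t (le_trans T0 Tt) zt).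
by rewrite ltNge Tt.
Qed.

Lemma settles_within_fixed_time_stable T :
  settles_within dot F zs T -> fixed_time_stable dot F zs.
Proof.
move=> hT; split; last by exists T.
split; first exact: dissipative_lyapunov_stable.
by move=> z hz; rewrite (le_lt_trans (hT z hz)) ?ltry.
Qed.

Definition decay_rate (l : R -> R) :=
  (forall v, 0 < v -> 0 < l v) /\
  (forall x, x != zs -> dot (F x) (x - zs) <= - l (E x)).

Lemma settles_within_bounded_potential (G l : R -> R) (T : R) : decay_rate l ->
  (forall v : R, 0 < v -> is_derive v 1 G (l v)^-1) ->
  (forall v : R, 0 < v -> 0 <= G v < T) ->
  settles_within dot F zs T.
Proof.
move=> [l0 Fl] dG GT.
have T0 : 0 <= T by have /andP[G0 /ltW] := GT 1 ltr01; exact: le_trans.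
apply: settles_within_of_bound => // z hz t t0 zt.
have before := unsettled_before _ hdot hfin _ _ F_cont F_dissip _ hz.
have := potential_time _ hdot hfin _ _ F_cont F_dissip _ hz G l 0 t t
  (lexx 0) t0 (lexx t) zt l0 dG Fl.
have /andP[_ G0T] : 0 <= G (E (z 0)) < T.
  by apply: GT; rewrite energy_gt0 (before 0 t).
have /andP[Gt0 _] : 0 <= G (E (z t)) < T by apply: GT; rewrite energy_gt0.
by rewrite /E in G0T Gt0 *; lra.
Qed.

(** [G1] controls the time spent below the level 1 of the energy and [G2] the
    time spent above it; the intermediate value theorem provides the time at
    which the level is crossed. *)
Lemma settles_within_two_potentials (G1 l1 G2 l2 : R -> R) :
  decay_rate l1 -> decay_rate l2 ->
  (forall v : R, 0 < v -> is_derive v 1 G1 (l1 v)^-1) ->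
  (forall v : R, 0 < v -> is_derive v 1 G2 (l2 v)^-1) ->
  (forall v : R, 0 < v -> 0 < G1 v) -> (forall v : R, 0 < v -> G2 v < 0) ->
  (forall v : R, 0 < v -> v <= 1 -> G1 v <= G1 1) ->
  (forall v : R, 1 <= v -> G2 1 <= G2 v) ->
  settles_within dot F zs (G1 1 - G2 1).
Proof.
move=> [l10 Fl1] [l20 Fl2] dG1 dG2 G1pos G2neg G1mono G2mono.
have G11 := G1pos 1 ltr01; have G21 := G2neg 1 ltr01.
apply: settles_within_of_bound => [|z hz t t0 zt]; first by lra.
have before s : 0 <= s -> s <= t -> 0 < E (z s).
  move=> s0 st; rewrite energy_gt0.
  exact: (unsettled_before _ hdot hfin _ _ F_cont F_dissip _ hz _ t).
have time1 s u : 0 <= s -> s <= u -> u <= t ->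
    u - s <= G1 (E (z s)) - G1 (E (z u)).
  move=> s0 su ut.
  exact: (potential_time _ hdot hfin _ _ F_cont F_dissip _ hz G1 l1 _ _ t).
have time2 s u : 0 <= s -> s <= u -> u <= t ->
    u - s <= G2 (E (z s)) - G2 (E (z u)).
  move=> s0 su ut.
  exact: (potential_time _ hdot hfin _ _ F_cont F_dissip _ hz G2 l2 _ _ t).
have Ez0 := before 0 (lexx 0) t0; have Ezt := before t t0 (lexx t).
have [z01|z01] := leP (E (z 0)) 1.
  have := time1 0 t (lexx 0) t0 (lexx t); have := G1mono _ Ez0 z01.
  by have := G1pos _ Ezt; lra.
have [zt1|zt1] := leP 1 (E (z t)).
  have := time2 0 t (lexx 0) t0 (lexx t); have := G2mono _ zt1.
  by have := G2neg _ Ez0; lra.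
have [u u0t Eu] : exists2 u, u \in `[0, t] & E (z u) = 1.
  apply: (@IVT _ (E \o z)) => //.
    exact: (energy_within _ hdot hfin _ _ _ hz).
  by rewrite /= ge_min le_max (ltW zt1) (ltW z01) orbT.
move: u0t; rewrite in_itv/= => /andP[u0 ut].
have := time2 0 u (lexx 0) u0 ut; have := time1 u t u0 ut (lexx t).
by rewrite Eu; have := G2neg _ Ez0; have := G1pos _ Ezt; lra.
Qed.

(** Common form of the power potentials ([psi] the identity) and of the
    logarithmic ones ([psi w = ln (1 + D / M * w)]): the exponent [1 - r] is
    positive below the level 1 and negative above it, so in both regimes
    [v `^ (1 - r)] lies between 0 and 1. *)
Lemma settles_within_power_potentials (l1 l2 psi1 psi2 : R -> R)
    (k1 k2 r1 r2 : R) :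
  0 < k1 -> 0 < k2 -> r1 < 1 -> 1 < r2 -> decay_rate l1 -> decay_rate l2 ->
  (forall v : R, 0 < v ->
    is_derive v 1 (fun v => psi1 (v `^ (1 - r1)) / (k1 * (1 - r1)))
      (l1 v)^-1) ->
  (forall v : R, 0 < v ->
    is_derive v 1 (fun v => psi2 (v `^ (1 - r2)) / (k2 * (1 - r2)))
      (l2 v)^-1) ->
  (forall w : R, 0 < w -> 0 < psi1 w) -> (forall w : R, 0 < w -> 0 < psi2 w) ->
  (forall w : R, 0 < w -> w <= 1 -> psi1 w <= psi1 1) ->
  (forall w : R, 0 < w -> w <= 1 -> psi2 w <= psi2 1) ->
  settles_within dot F zs (psi1 1 / (k1 * (1 - r1)) + psi2 1 / (k2 * (r2 - 1))).
Proof.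
move=> k10 k20 r1lt r2gt hl1 hl2 d1 d2 p1 p2 m1 m2.
have one (q : R) : 1 `^ q = 1 by rewrite powR1.
have c1 : 0 < (k1 * (1 - r1))^-1 by rewrite invr_gt0 mulr_gt0// subr_gt0.
have c2 : (k2 * (1 - r2))^-1 < 0 by rewrite invr_lt0 pmulr_rlt0// subr_lt0.
have := settles_within_two_potentials _ _ _ _ hl1 hl2 d1 d2.
rewrite !one -mulrN -invrN -mulrN opprB; apply.
- by move=> v v0; rewrite pmulr_lgt0// p1// powR_gt0.
- by move=> v v0; rewrite nmulr_llt0// p2// powR_gt0.
- move=> v v0 v1; rewrite ler_pM2r// m1 ?powR_gt0// -[leRHS](one (1 - r1)).
  by rewrite ge0_ler_powR// ?nnegrE ?subr_ge0 ltW.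
- move=> v v1; have v0 : 0 < v by exact: lt_le_trans v1.
  rewrite ler_nM2r// m2 ?powR_gt0// -opprB powRN invf_le1 ?powR_gt0//.
  by rewrite -[leLHS](one (r2 - 1)) ge0_ler_powR// ?nnegrE ?subr_ge0 ?ltW.
Qed.

End Settling.

(** * The vector field *)

Lemma powR_continuous {R : realType} (q u : R) : 0 < u ->
  {for u, continuous (fun x => x `^ q)}.
Proof.
move=> u0; have dp := @is_derive1_powR R q u u0.
exact/differentiable_continuous/derivable1_diffP.
Qed.

(** Turns a term of omega, evaluated at a multiple of the distance [n] to the
    equilibrium, into a power of the energy [n ^+ 2 / 2]. *)
Lemma powR_energy {R : realType} (p k n : R) : 0 < k -> 0 < n ->
  (k * n) `^ (- (1 - p)) * n ^+ 2 =
  k `^ (p - 1) * 2 `^ ((1 + p) / 2) * (n ^+ 2 / 2) `^ ((1 + p) / 2).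
Proof.
move=> k0 n0; rewrite opprB powRM ?ltW// -[LHS]mulrA -[RHS]mulrA; congr (_ * _).
rewrite -powRM ?divr_ge0 ?exprn_ge0 ?(ltW n0)// (mulrC 2) divfK//.
rewrite -!powR_mulrn ?(ltW n0)// -powRrM -powRD; last first.
  by rewrite (gt_eqF n0) implybT.
by congr (_ `^ _); field.
Qed.

Section Flow.
Context {R : realType} {H : normedModType R} (dot : {dot H for idfun}).
Hypothesis hdot : induces_norm dot.
Context (T : H -> H) (c : R) (zs : H).
Hypothesis c_ge0 : 0 <= c.
Hypothesis c_lt1 : c < 1.
Hypothesis T_lip : c.-lipschitz T.
Hypothesis T_fix : T zs = zs.

Let Phi (x : H) := x - T x.

Lemma contraction_dist x y : `|T x - T y| <= c * `|x - y|.
Proof. exact: (T_lip (x, y)). Qed.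

Lemma residual_fixed : Phi zs = 0.
Proof. by rewrite /Phi T_fix subrr. Qed.

Lemma residualE x : Phi x = (x - zs) - (T x - T zs).
Proof. by rewrite T_fix /Phi opprB addrA subrK. Qed.

Lemma residual_norm_le x : `|Phi x| <= (1 + c) * `|x - zs|.
Proof.
rewrite residualE (le_trans (ler_normB _ _))// mulrDl mul1r lerD2l.
exact: contraction_dist.
Qed.

Lemma residual_norm_ge x : (1 - c) * `|x - zs| <= `|Phi x|.
Proof.
rewrite residualE (le_trans _ (lerB_dist _ _))// mulrBl mul1r lerD2l lerN2.
exact: contraction_dist.
Qed.

Lemma residual_dot_ge x : (1 - c) * `|x - zs| ^+ 2 <= dot (Phi x) (x - zs).
Proof.
rewrite residualE (dotDl dot) (dotNl dot) -hdot mulrBl mul1r lerD2l lerN2.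
rewrite (le_trans (dot_le_norm _ hdot _ _))// expr2 mulrA ler_wpM2r//.
exact: contraction_dist.
Qed.

Lemma residual_neq0 x : x != zs -> Phi x != 0.
Proof.
move=> xzs; rewrite -normr_gt0 (lt_le_trans _ (residual_norm_ge x))//.
by rewrite mulr_gt0 ?subr_gt0// normr_gt0 subr_eq0.
Qed.

Lemma residual_continuous : continuous Phi.
Proof.
move=> x; apply: cvgB; first exact: cvg_id.
apply/cvgrPdist_le => eps eps0; near=> y.
rewrite (le_trans (contraction_dist _ _))// (@le_trans _ _ `|x - y|)//.
  by rewrite ler_piMl// ltW.
Unshelve. all: by end_near. Qed.

Context (Kp b1 b2 b3 p1 p2 p3 Tp : R).
Hypothesis Kp_gt0 : 0 < Kp.
Hypothesis Tp_gt0 : 0 < Tp.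
Hypothesis b1_gt0 : 0 < b1.
Hypothesis b2_gt0 : 0 < b2.
Hypothesis b3_gt0 : 0 < b3.
Hypothesis p1_lt1 : p1 < 1.
Hypothesis p2_gt1 : 1 < p2.

Let F := flow_field Kp b1 b2 b3 p1 p2 p3 Phi Tp.

Lemma flow_field_equilibrium : equilibrium F zs.
Proof. by rewrite /equilibrium /F /flow_field residual_fixed scaler0 oppr0. Qed.

Lemma flow_field_continuous x : x != zs -> {for x, continuous F}.
Proof.
move=> xzs; have Px := residual_neq0 _ xzs.
have nPx : 0 < `|Phi x| by rewrite normr_gt0.
pose w y := b1 * `|Phi y| `^ (- (1 - p1)) + b2 * `|Phi y| `^ (- (1 - p2))
  + b3 * `|Phi y| `^ (- p3).
have cpow q b : b * `|Phi y| `^ q @[y --> x] --> b * `|Phi x| `^ q.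
  apply: cvgM; first exact: cvg_cst.
  apply: (@cvg_comp _ _ _ (fun y => `|Phi y|) (fun r => r `^ q)).
    by apply: cvg_norm; exact: residual_continuous.
  exact: powR_continuous.
have cF : - ((Kp / Tp * w y) *: Phi y) @[y --> x] -->
    - ((Kp / Tp * w x) *: Phi x).
  apply: cvgN; apply: cvgZ; last exact: residual_continuous.
  by apply: cvgM; [exact: cvg_cst|apply: cvgD => //; exact: cvgD].
have eF y : Phi y != 0 -> F y = - ((Kp / Tp * w y) *: Phi y).
  by move=> /negbTE Py; rewrite /F /flow_field /omega Py.
rewrite /prop_for /continuous_at eF//; apply: cvg_trans cF; apply: near_eq_cvg.
near=> y; rewrite eF//; near: y.
exact: (cvgr_neq0 _ (residual_continuous x) Px).
Unshelve. all: by end_near. Qed.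

(** The constants [M1] ([b1], [k = 1 + c], [p1]) and [M2] ([b2], [k = 1 - c],
    [p2]) of the energy inequality. *)
Definition decay_coef (b k p : R) :=
  Kp / Tp * (1 - c) * b * k `^ (p - 1) * 2 `^ ((1 + p) / 2).

Lemma decay_coef_gt0 b k p : 0 < b -> 0 < k -> 0 < decay_coef b k p.
Proof.
move=> b0 k0; rewrite !mulr_gt0 ?powR_gt0 ?invr_gt0 ?subr_gt0//.
Qed.

(** The exponent [p1 - 1] is negative and [p2 - 1] positive, so the first term
    of omega is bounded below by the upper estimate of the residual and the
    second by its lower estimate; hence [1 + c] and [1 - c]. *)
Lemma flow_field_decay x : x != zs ->
  dot (F x) (x - zs) <=
  - (decay_coef b1 (1 + c) p1 * energy zs x `^ ((1 + p1) / 2) +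
     decay_coef b2 (1 - c) p2 * energy zs x `^ ((1 + p2) / 2) +
     2 * (Kp / Tp) * (1 - c) * b3 * `|Phi x| `^ (- p3) * energy zs x).
Proof.
move=> xzs; have Px := residual_neq0 _ xzs.
have n0 : 0 < `|x - zs| by rewrite normr_gt0 subr_eq0.
have m0 : 0 < `|Phi x| by rewrite normr_gt0.
have hi := residual_norm_le x; have lo := residual_norm_ge x.
rewrite /F /flow_field (dotNl dot) (dotZl dot) lerN2 /omega (negbTE Px).
have dd := residual_dot_ge x.
set w := b1 * `|Phi x| `^ _ + _ + _.
have cp : 0 < 1 - c by rewrite subr_gt0.
have cp' : 0 < 1 + c by rewrite ltr_pwDl.
have kap : 0 < Kp / Tp by rewrite divr_gt0.
have h1 : ((1 + c) * `|x - zs|) `^ (- (1 - p1)) <= `|Phi x| `^ (- (1 - p1)).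
  rewrite !powRN lef_pV2 ?posrE ?powR_gt0 ?mulr_gt0//.
  by rewrite ge0_ler_powR// ?nnegrE ?mulr_ge0 ?subr_ge0// ltW.
have h2 : ((1 - c) * `|x - zs|) `^ (- (1 - p2)) <= `|Phi x| `^ (- (1 - p2)).
  by rewrite opprB ge0_ler_powR// ?nnegrE ?mulr_ge0 ?subr_ge0// ltW.
have w0 : 0 < w by rewrite !addr_gt0 ?mulr_gt0 ?powR_gt0.
apply: (@le_trans _ _ (Kp / Tp * w * ((1 - c) * `|x - zs| ^+ 2))); last first.
  by rewrite ler_pM2l// mulr_gt0.
rewrite /decay_coef /energy.
have e1 := powR_energy p1 (1 + c) `|x - zs| cp' n0.
have e2 := powR_energy p2 (1 - c) `|x - zs| cp n0.
have assoc q a1 a2 a3 a4 a5 : q * a1 * a2 * a3 * a4 * a5 =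
    q * a1 * a2 * (a3 * a4 * a5) :> R by rewrite !mulrA.
rewrite (assoc _ _ b1) (assoc _ _ b2) -e1 -e2.
set A := _ `^ _ in h1 *; set B := _ `^ _ in h2 *.
have -> :
  Kp / Tp * (1 - c) * b1 * (A * `|x - zs| ^+ 2) +
  Kp / Tp * (1 - c) * b2 * (B * `|x - zs| ^+ 2) +
  2 * (Kp / Tp) * (1 - c) * b3 * `|Phi x| `^ (- p3) * (`|x - zs| ^+ 2 / 2) =
  Kp / Tp * (b1 * A + b2 * B + b3 * `|Phi x| `^ (- p3)) *
    ((1 - c) * `|x - zs| ^+ 2).
  by field; rewrite gt_eqF.
rewrite ler_pM2r; last by rewrite mulr_gt0// exprn_gt0.
by rewrite ler_pM2l// /w lerD2r lerD// ler_pM2l.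
Qed.

End Flow.

(** * Settling times of the flow *)

Section SettlingTime.
Context {R : realType} {H : normedModType R} (dot : {dot H for idfun}).
Hypothesis hdot : induces_norm dot.
Hypothesis hfin : finite_dimensional H.
Context (T : H -> H) (c : R) (zs : H).
Hypothesis c_ge0 : 0 <= c.
Hypothesis c_lt1 : c < 1.
Hypothesis T_lip : c.-lipschitz T.
Hypothesis T_fix : T zs = zs.
Context (Kp b1 b2 b3 p1 p2 p3 Tp : R).
Hypothesis Kp_gt0 : 0 < Kp.
Hypothesis Tp_gt0 : 0 < Tp.
Hypothesis b1_gt0 : 0 < b1.
Hypothesis b2_gt0 : 0 < b2.
Hypothesis b3_gt0 : 0 < b3.
Hypothesis p1_lt1 : p1 < 1.
Hypothesis p2_gt1 : 1 < p2.

Let Phi (x : H) := x - T x.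
Let F := flow_field Kp b1 b2 b3 p1 p2 p3 Phi Tp.
Let M1 := decay_coef c Kp Tp b1 (1 + c) p1.
Let M2 := decay_coef c Kp Tp b2 (1 - c) p2.
Let r1 := (1 + p1) / 2.
Let r2 := (1 + p2) / 2.

Lemma near_coef_gt0 : 0 < M1.
Proof. by apply: decay_coef_gt0 => //; rewrite ltr_pwDl. Qed.

Lemma far_coef_gt0 : 0 < M2.
Proof. by apply: decay_coef_gt0 => //; rewrite subr_gt0. Qed.

Let F_cont x : x != zs -> {for x, continuous F}.
Proof. exact: (flow_field_continuous T c zs c_lt1 T_lip T_fix). Qed.

Lemma flow_decay_rate (l : R -> R) :
  (forall v, 0 < v -> 0 < l v) ->
  (forall v, 0 < v -> l v <= M1 * v `^ r1 + M2 * v `^ r2) ->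
  decay_rate dot F zs l.
Proof.
move=> l0 lM; split => // x xzs.
have Ex : 0 < energy zs x by rewrite energy_gt0.
apply: le_trans (flow_field_decay _ hdot _ _ _ c_ge0 c_lt1 T_lip T_fix _ _ _ _
  _ _ p3 _ Kp_gt0 Tp_gt0 b1_gt0 b2_gt0 b3_gt0 p1_lt1 p2_gt1 x xzs) _.
rewrite lerN2 (le_trans (lM _ Ex))// lerDl mulr_ge0 ?(ltW Ex)//.
rewrite mulr_ge0 ?powR_ge0// mulr_ge0 ?(ltW b3_gt0)// mulr_ge0 ?subr_ge0 ?ltW//.
by rewrite mulr_gt0// divr_gt0.
Qed.

Lemma flow_dissipative x : x != zs -> dot (F x) (x - zs) <= 0.
Proof.
have [_ hl] : decay_rate dot F zs (fun v => M1 * v `^ r1 + M2 * v `^ r2).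
  apply: flow_decay_rate => // v v0.
  exact: addr_gt0 (mulr_gt0 near_coef_gt0 (powR_gt0 _ v0))
    (mulr_gt0 far_coef_gt0 (powR_gt0 _ v0)).
move=> xzs; rewrite (le_trans (hl _ xzs))// oppr_le0.
exact: addr_ge0 (mulr_ge0 (ltW near_coef_gt0) (powR_ge0 _ _))
  (mulr_ge0 (ltW far_coef_gt0) (powR_ge0 _ _)).
Qed.

Let r1_lt1 : r1 < 1.
Proof.
by rewrite ltr_pdivrMr// mul1r -ltrBrDl; apply: lt_le_trans p1_lt1 _; lra.
Qed.

Let r2_gt1 : 1 < r2.
Proof.
by rewrite ltr_pdivlMr// mul1r -ltrBlDl; apply: le_lt_trans p2_gt1; lra.
Qed.

Lemma flow_settles_power :
  settles_within dot F zs ((M1 * (1 - r1))^-1 + (M2 * (r2 - 1))^-1).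
Proof.
have m1 := near_coef_gt0; have m2 := far_coef_gt0.
rewrite -[X in X + _]mul1r -[X in _ + X]mul1r.
apply: (settles_within_power_potentials dot hdot hfin F zs F_cont
  flow_dissipative (fun v => M1 * v `^ r1) (fun v => M2 * v `^ r2) id id) => //.
- apply: flow_decay_rate => v v0; first exact: mulr_gt0 m1 (powR_gt0 _ v0).
  by rewrite lerDl; exact: mulr_ge0 (ltW m2) (powR_ge0 _ _).
- apply: flow_decay_rate => v v0; first exact: mulr_gt0 m2 (powR_gt0 _ v0).
  by rewrite lerDr; exact: mulr_ge0 (ltW m1) (powR_ge0 _ _).
- by move=> v v0; apply: pow_potential_derive => //; rewrite lt_eqF.
- by move=> v v0; apply: pow_potential_derive => //; rewrite gt_eqF.
Qed.

Lemma flow_settles_atan (alpha : R) : 1 < alpha ->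
  r1 = 1 - (2 * alpha)^-1 -> r2 = 1 + (2 * alpha)^-1 ->
  settles_within dot F zs (pi * alpha / Num.sqrt (M1 * M2)).
Proof.
move=> al1 r1E r2E; have m1 := near_coef_gt0; have m2 := far_coef_gt0.
have al0 : 0 < alpha by exact: lt_trans al1.
have s0 : 0 < Num.sqrt (M1 * M2) by rewrite sqrtr_gt0 mulr_gt0.
apply: (settles_within_bounded_potential dot hdot hfin F zs F_cont
  flow_dissipative (fun v => 2 * alpha / Num.sqrt (M1 * M2) *
      atan (Num.sqrt (M1 * M2) / M1 * v `^ (2 * alpha)^-1))
  (fun v => M1 * v `^ r1 + M2 * v `^ r2)) => [|v v0|v v0].
- apply: flow_decay_rate => // v v0.
  exact: addr_gt0 (mulr_gt0 m1 (powR_gt0 _ v0)) (mulr_gt0 m2 (powR_gt0 _ v0)).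
- by rewrite r1E r2E; exact: atan_potential_derive.
- set w := _ * v `^ _; have w0 : 0 <= w.
    by rewrite mulr_ge0 ?powR_ge0// divr_ge0 ?ltW.
  have k0 : 0 < 2 * alpha / Num.sqrt (M1 * M2) by rewrite divr_gt0 ?mulr_gt0.
  apply/andP; split.
    by rewrite mulr_ge0 ?(ltW k0)// -[leLHS](@atan0 R) le_atan.
  have -> : pi * alpha / Num.sqrt (M1 * M2) =
      2 * alpha / Num.sqrt (M1 * M2) * (pi / 2).
    by field; rewrite gt_eqF.
  by rewrite ltr_pM2l// atan_ltpi2.
Qed.

Lemma flow_settles_log : p3 = 0 ->
  let D := 2 * (Kp / Tp) * (1 - c) * b3 in
  settles_within dot F zs
    (ln (1 + D / M1) / (D * (1 - r1)) + ln (1 + D / M2) / (D * (r2 - 1))).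
Proof.
move=> p30 D; have m1 := near_coef_gt0; have m2 := far_coef_gt0.
have D0 : 0 < D by rewrite !mulr_gt0 ?invr_gt0 ?subr_gt0.
have decay x : x != zs -> dot (F x) (x - zs) <=
  - (M1 * energy zs x `^ r1 + M2 * energy zs x `^ r2 + D * energy zs x).
  move=> xzs; have := flow_field_decay _ hdot _ _ _ c_ge0 c_lt1 T_lip T_fix
    _ _ _ _ _ _ p3 _ Kp_gt0 Tp_gt0 b1_gt0 b2_gt0 b3_gt0 p1_lt1 p2_gt1 x xzs.
  by rewrite p30 oppr0 powRr0 mulr1 -/D /F p30.
have ln_pos M w : 0 < M -> 0 < w -> 0 < ln (1 + D / M * w).
  by move=> M0 w0; rewrite ln_gt0// ltrDl; exact: mulr_gt0 (divr_gt0 D0 M0) w0.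
have ln_mono M w : 0 < M -> 0 < w -> w <= 1 ->
    ln (1 + D / M * w) <= ln (1 + D / M * 1).
  move=> M0 w0 w1; have DM : 0 < D / M by exact: divr_gt0.
  have pos u : 0 < u -> 1 + D / M * u \is Num.pos.
    by move=> u0; rewrite posrE; exact: addr_gt0 ltr01 (mulr_gt0 DM u0).
  by rewrite ler_ln ?pos// lerD2l ler_pM2l.
suff : settles_within dot F zs (ln (1 + D / M1 * 1) / (D * (1 - r1)) +
    ln (1 + D / M2 * 1) / (D * (r2 - 1))).
  by rewrite !mulr1.
apply: (settles_within_power_potentials dot hdot hfin F zs F_cont
  flow_dissipative (fun v => M1 * v `^ r1 + D * v)
  (fun v => M2 * v `^ r2 + D * v)
  (fun w => ln (1 + D / M1 * w)) (fun w => ln (1 + D / M2 * w))) => //.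
- split => [v v0|x xzs]; first
    exact: addr_gt0 (mulr_gt0 m1 (powR_gt0 _ v0)) (mulr_gt0 D0 v0).
  rewrite (le_trans (decay x xzs))// lerN2 lerD2r lerDl.
  exact: mulr_ge0 (ltW m2) (powR_ge0 _ _).
- split => [v v0|x xzs]; first
    exact: addr_gt0 (mulr_gt0 m2 (powR_gt0 _ v0)) (mulr_gt0 D0 v0).
  rewrite (le_trans (decay x xzs))// lerN2 lerD2r lerDr.
  exact: mulr_ge0 (ltW m1) (powR_ge0 _ _).
- by move=> v v0; apply: log_potential_derive => //; rewrite lt_eqF.
- by move=> v v0; apply: log_potential_derive => //; rewrite gt_eqF.
- by move=> w; exact: ln_pos.
- by move=> w; exact: ln_pos.
- by move=> w; exact: ln_mono.
- by move=> w; exact: ln_mono.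
Qed.

(** [Kp] and [Tp] enter the decay rates only through the factor [Kp / Tp], which
    cancels in the quotients [D / M1] and [D / M2]. *)
Lemma predefined_gain_settling :
  let D := 2 * (Kp / Tp) * (1 - c) * b3 in
  ln (1 + D / M1) / (D * (1 - r1)) + ln (1 + D / M2) / (D * (r2 - 1)) =
  Tp / Kp * predefined_gain b1 b2 b3 p1 p2 c.
Proof.
move=> D.
have cp : 0 < 1 - c by rewrite subr_gt0.
have cp' : 0 < 1 + c by rewrite ltr_pwDl.
have quot b k p : 0 < b -> 0 < k -> D / decay_coef c Kp Tp b k p =
    b3 * 2 `^ ((1 - p) / 2) * k `^ (1 - p) / b.
  move=> b0 k0; rewrite /D /decay_coef.
  have -> : 2 `^ ((1 - p) / 2) = 2 / 2 `^ ((1 + p) / 2) :> R.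
    have two : 2 `^ ((1 - p) / 2) * 2 `^ ((1 + p) / 2) = 2 :> R.
      rewrite -powRD ?pnatr_eq0 ?implybT//.
      have -> : (1 - p) / 2 + (1 + p) / 2 = 1 by field.
      by rewrite powRr1.
    by rewrite -[X in _ = X / _]two mulfK// gt_eqF// powR_gt0.
  have -> : k `^ (1 - p) = (k `^ (p - 1))^-1 by rewrite -powRN opprB.
  by field; rewrite !gt_eqF ?powR_gt0//.
rewrite /M1 /M2 !quot// /predefined_gain /D /r1 /r2 [RHS]mulrDr.
by congr (_ + _); field; rewrite !gt_eqF ?subr_gt0//.
Qed.

Lemma flow_fixed_time_stable : fixed_time_stable dot F zs.
Proof.
apply: settles_within_fixed_time_stable flow_settles_power => //.
- exact: flow_dissipative.
- exact: flow_field_equilibrium.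
Qed.

End SettlingTime.

Theorem proposition5p1 (R : realType) (H : normedModType R)
    (dot : {dot H for idfun}) (hdot : induces_norm dot)
    (hfin : finite_dimensional H)
    (h : H -> R^o) (phi : H -> \bar R) (eta L gamma : R)
    (hC1 : continuously_differentiable dot h)
    (hconv : convex_function setT h)
    (phi_proper : proper_function phi) (phi_conv : ereal_convex phi)
    (phi_lsc : lower_semicontinuous phi)
    (eta_gt0 : 0 < eta) (hstrong : strongly_convex dot eta h)
    (L_gt0 : 0 < L) (hlip : L.-lipschitz (gradient dot h))
    (gamma_gt0 : 0 < gamma) (hgamma : gamma * L ^+ 2 < 2 * eta)
    (zs : H) (hzs : is_minimizer (fun z => (h z)%:E + phi z)%E zs)
    (b1 b2 b3 p1 p2 p3 Kp Tp : R)
    (b1_gt0 : 0 < b1) (b2_gt0 : 0 < b2) (b3_gt0 : 0 < b3)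
    (p1_gt0 : 0 < p1) (p1_lt1 : p1 < 1) (p2_gt1 : 1 < p2) (p3_ge0 : 0 <= p3)
    (Kp_gt0 : 0 < Kp) (Tp_gt0 : 0 < Tp) :
  let Phi := residual dot h phi gamma in
  let F := flow_field Kp b1 b2 b3 p1 p2 p3 Phi in
  [/\ fixed_time_stable dot (F Tp) zs,
      (* r1 and r2 are tied to p1 and p2 so that the last clause, conditional
         on the form of r1 and r2, cannot be made vacuous by choosing them *)
      exists M1 M2 r1 r2 : R,
        [/\ [/\ 0 < M1, 0 < M2, 2^-1 < r1 < 1 & 1 < r2],
            r1 = (1 + p1) / 2 /\ r2 = (1 + p2) / 2,
            settles_within dot (F Tp) zs
              ((M1 * (1 - r1))^-1 + (M2 * (r2 - 1))^-1) &
            forall alpha : R, 1 < alpha ->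
              r1 = 1 - (2 * alpha)^-1 -> r2 = 1 + (2 * alpha)^-1 ->
              settles_within dot (F Tp) zs (pi * alpha / Num.sqrt (M1 * M2))] &
      forall c : R, 0 < c < 1 ->
        c.-lipschitz (forward_backward dot h phi gamma) ->
        p3 = 0 -> Kp = predefined_gain b1 b2 b3 p1 p2 c ->
        predefined_time_stable dot F zs].
Proof.
move=> Phi F.
have subg := fermat_subgradient _ hdot hfin _ phi_proper phi_conv _ _
  (hC1.1 zs) hzs.
have fix_zs : forward_backward dot h phi gamma zs = zs.
  exact: (minimizer_forward_backward _ hdot hfin _ _ phi_proper phi_conv phi_lsc
    gamma_gt0 _ _ subg _ _ (hC1.1 zs) hzs).
have [c0 /andP[c00 c01] lip0] := forward_backward_lipschitz _ hdot hfin _ _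
  phi_proper phi_conv phi_lsc gamma_gt0 _ _ subg _ _ _
  hstrong L_gt0 hlip hgamma.
split.
- exact: (flow_fixed_time_stable dot hdot hfin _ _ _ (ltW c00) c01 lip0 fix_zs).
- exists (decay_coef c0 Kp Tp b1 (1 + c0) p1),
    (decay_coef c0 Kp Tp b2 (1 - c0) p2), ((1 + p1) / 2), ((1 + p2) / 2).
  split => //.
  + split; first exact: (near_coef_gt0 c0 (ltW c00)).
    - exact: (far_coef_gt0 c0 c01).
    - by apply/andP; split; lra.
    - by lra.
  + exact: (flow_settles_power dot hdot hfin _ _ _ (ltW c00) c01 lip0 fix_zs).
  + exact: (flow_settles_atan dot hdot hfin _ _ _ (ltW c00) c01 lip0 fix_zs).
- move=> c /andP[c_gt0 c_lt1] lip p30 KpE T' T'0.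
  have settle := flow_settles_log dot hdot hfin _ _ _ (ltW c_gt0) c_lt1 lip
    fix_zs Kp b1 b2 b3 p1 p2 p3 T' Kp_gt0 T'0 b1_gt0 b2_gt0 b3_gt0
    p1_lt1 p2_gt1 p30.
  split.
    exact: (flow_fixed_time_stable dot hdot hfin _ _ _ (ltW c00) c01 lip0
      fix_zs).
  move: settle => /=; rewrite predefined_gain_settling//; last exact: ltW.
  by rewrite -KpE divfK ?gt_eqF.
Qed.
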